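(* Let $\Bbbk$ be a field and let $m \geq 2$ be an integer. There are infinitely many positive, non-saturated lattices $\mathscr{L} \subset \mathbb{Z}^n$ (where $n$ is allowed to depend on $\mathscr{L}$) of rank $m$ such that one of the ideals $I_{\mathscr{L}}$, $I_{\mathscr{L}^{\mathrm{sat}}}$ of $\Bbbk[x_1,\dots,x_n]$ is a complete intersection, and the other one is not Cohen--Macaulay.
   Context: A lattice $\mathscr{L}\subset\mathbb{Z}^n$ is a subgroup of $\mathbb{Z}^n$; here $\mathbb{N}=\{0,1,2,\dots\}$. The lattice is positive if $\mathscr{L}\cap\mathbb{N}^n=\{0\}$. Its saturation is $\mathscr{L}^{\mathrm{sat}}=\{u\in\mathbb{Z}^n \mid k u\in\mathscr{L}\text{ for some positive integer } k\}$, and $\mathscr{L}$ is saturated if $\mathscr{L}=\mathscr{L}^{\mathrm{sat}}$. The lattice ideal of $\mathscr{L}$ is $I_{\mathscr{L}}=\langle x^a-x^b \mid a,b\in\mathbb{N}^n,\ a-b\in\mathscr{L}\rangle\subset\Bbbk[x_1,\dots,x_n]$. The codimension of $I_{\mathscr{L}}$ equals the rank of $\mathscr{L}$. The ideal $I_{\mathscr{L}}$ is called Cohen--Macaulay if the quotient ring $\Bbbk[x_1,\dots,x_n]/I_{\mathscr{L}}$ is Cohen--Macaulay, and is called a complete intersection if it can be generated by as many elements as its codimension. *)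

(* Defs.v *)
From HB Require Import structures.
From mathcomp Require Import all_boot all_order all_algebra.
From mathcomp Require Import boolp classical_sets cardinality.
From mathcomp Require Import mpoly.

Set Implicit Arguments.
Unset Strict Implicit.
Unset Printing Implicit Defensive.

Import GRing.Theory.
Local Open Scope classical_set_scope.
Local Open Scope ring_scope.

(* Ideals of a commutative ring are boolean predicates, as in ring_quotient;
   by classical logic these are all the subsets.  Beware that idealr_closed
   already says that the ideal is proper. *)

Section IdealTheory.
Variable A : comNzRingType.
Implicit Types (I J P : {pred A}) (S : set A) (s f : seq A).

Definition ideal_gen S : {pred A} := fun x =>
  `[< exists s : seq (A * A),
        (forall p, p \in s -> S p.2) /\ x = \sum_(p <- s) p.1 * p.2 >].

Definition prime_ideal P := idealr_closed P /\ prime_idealr_closed P.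

Definition maximal_ideal P :=
  idealr_closed P /\
  forall J, idealr_closed J -> {subset P <= J} -> {subset J <= P}.

Definition noetherian :=
  forall J, idealr_closed J -> exists s, J =i ideal_gen [set` s].

Definition prime_chain P (h : nat) (Q : nat -> {pred A}) :=
  [/\ forall i, (i <= h)%N -> prime_ideal (Q i),
      forall i, (i < h)%N ->
        {subset Q i <= Q i.+1} /\ ~ {subset Q i.+1 <= Q i}
    & Q h =i P].

Definition prime_height P (h : nat) :=
  (exists Q, prime_chain P h Q) /\
  (forall h' Q, prime_chain P h' Q -> (h' <= h)%N).

(* The codimension (height) of I: the least height of a prime containing I.
   The second clause says "height at least c", so that primes of infinite
   height are also covered. *)
Definition codimension I (c : nat) :=
  (exists P, [/\ prime_ideal P, {subset I <= P} & prime_height P c]) /\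
  (forall P, prime_ideal P -> {subset I <= P} -> exists Q, prime_chain P c Q).

Definition complete_intersection I :=
  exists c, codimension I c /\
    exists g : c.-tuple A, I =i ideal_gen [set` g].

Definition regular_sequence f :=
  (forall i x, (i < size f)%N ->
     nth 0 f i * x \in ideal_gen [set` take i f] ->
     x \in ideal_gen [set` take i f]) /\
  1 \notin ideal_gen [set` f].

Definition ideal_depth P (d : nat) :=
  (exists f, [/\ regular_sequence f, {subset f <= P} & size f = d]) /\
  (forall f, regular_sequence f -> {subset f <= P} -> (size f <= d)%N).

(* Eisenbud, Commutative Algebra, Section 18.2: a Noetherian ring is
   Cohen-Macaulay if depth M = codim M for every maximal ideal M, the depth of
   M being the length of a maximal regular sequence in M. *)
Definition cohen_macaulay :=
  noetherian /\
  forall P, maximal_ideal P -> exists d, ideal_depth P d /\ prime_height P d.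

End IdealTheory.

Definition cohen_macaulay_ideal (A : comNzRingType) (I : idealr A) :=
  cohen_macaulay {ideal_quot I}.

Section Lattice.
Variable n : nat.
Implicit Types L : set 'rV[int]_n.

Definition lattice L := L 0 /\ forall u v, L u -> L v -> L (u - v).

Definition positive L :=
  L `&` [set u | forall i, (0 <= u 0 i)%R] = [set 0].

Definition saturation L : set 'rV[int]_n :=
  [set u | exists2 k : nat, (0 < k)%N & L (u *+ k)].

Definition saturated L := L = saturation L.

Definition lattice_rank L (r : nat) :=
  exists B : 'M[int]_(r, n),
    (forall c : 'rV[int]_r, c *m B = 0 -> c = 0) /\
    L = range (fun c : 'rV[int]_r => c *m B).

End Lattice.

Definition lattice_ideal (k : fieldType) n (L : set 'rV[int]_n) :
    {pred {mpoly k[n]}} :=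
  ideal_gen [set f | exists a b : 'X_{1..n},
    L (\row_i ((a i)%:Z - (b i)%:Z)) /\ f = 'X_[a] - 'X_[b]].

Arguments lattice_ideal k {n} L _.

Lemma lattice_ideal_closed (k : fieldType) n (L : set 'rV[int]_n) :
  idealr_closed (lattice_ideal k L).
Proof.
split.
- by apply/asboolP; exists [::]; rewrite big_nil.
- apply/negP => /asboolP[s [sS /(congr1 (meval (fun=> 1)))]].
  rewrite meval1 raddf_sum big_seq big1 => [/eqP|p /sS[a [b [_ e]]]].
    by rewrite oner_eq0.
  rewrite /= mevalM e mevalB !mevalX.
  by rewrite !big1 ?subrr ?mulr0 // => i _; rewrite expr1n.
- move=> a u v /asboolP[s [sS ->]] /asboolP[t [tS ->]]; apply/asboolP.
  exists ([seq (a * p.1, p.2) | p <- s] ++ t); split => [p|].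
    by rewrite mem_cat => /orP[/mapP[q /sS qS ->] //|/tS].
  rewrite big_cat big_map /= mulr_sumr; congr (_ + _).
  by apply: eq_bigr => p _; rewrite mulrA.
Qed.

HB.instance Definition _ (k : fieldType) n (L : set 'rV[int]_n) :=
  isIdealr.Build {mpoly k[n]} (lattice_ideal k L) (lattice_ideal_closed k L).

(* Main.v *)
Require Import Defs.
From mathcomp Require Import all_boot all_order all_algebra.
From mathcomp Require Import boolp classical_sets cardinality.
From mathcomp Require Import mpoly.
From HB Require Import structures.
From mathcomp Require Import zify.

Set Implicit Arguments.
Unset Strict Implicit.
Unset Printing Implicit Defensive.

Local Open Scope classical_set_scope.
Local Open Scope ring_scope.
Import GRing.Theory Num.Theory Order.TTheory.

(** With the degrees (1,0;0), (0,1;0), (r+1,0;1), (0,1;1), ..., (0,1;1) in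
    Z^2 x Z/2 for the m+2 variables X_0, X_1, ..., let L be the lattice of the
    relations between these degrees, and x, y, t the monomials of degrees
    (1,0;0), (0,1;0), (0,0;1).  The saturation of L forgets the Z/2 component;
    its ideal is generated by the m binomials X_i - (monomial in X_0, X_1), with
    i >= 2, and the quotient is a polynomial ring in two variables.  On the other
    hand w = x^r t does not belong to k[X]/I_L, although w X_i does for all i.
    For a regular sequence f, g in the maximal ideal of the origin, the equality
    g (w f) = f (w g) shows that w f is a multiple of f, so that w would belong to
    the ring: the depth is at most 1, whereas the dimension is 2.

    That the ideal of the saturation has height at most m is a count of
    algebraically independent elements: if y_1, ..., y_s are independent modulo
    a prime Q', and x belongs to Q' but not to the prime Q below Q', then
    y_1, ..., y_s, x are independent modulo Q.  A chain of length h ending at a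
    prime modulo which X_0 and X_1 are independent thus yields h+2 independent
    elements of k[X_0, ..., X_(m+1)], and h+2 <= m+2. *)

(** * Substitutions, and polynomials as univariate in their last variable *)

Lemma mpoly_rmorph_eq (R S : comNzRingType) n (f g : {rmorphism {mpoly R[n]} -> S}) :
  (forall c, f c%:MP = g c%:MP) -> (forall i, f 'X_i = g 'X_i) -> f =1 g.
Proof.
move=> fgC fgX p; rewrite (mpolyE p) !rmorph_sum; apply: eq_bigr => u _ /=.
rewrite -mul_mpolyC !rmorphM fgC mpolyXE_id !rmorph_prod; congr (_ * _).
by apply: eq_bigr => i _; rewrite !rmorphXn fgX.
Qed.

Lemma tuple_of_tnth n T (f : 'I_n -> T) i : tnth [tuple f j | j < n] i = f i.
Proof. by rewrite tnth_map tnth_ord_tuple. Qed.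

Lemma comp_mpolyX_tnth (R : comNzRingType) n r (y : n.-tuple {mpoly R[r]}) i :
  'X_i \mPo y = tnth y i.
Proof. by rewrite comp_mpolyXU -tnth_nth. Qed.

Section Univariate.
Variables (R : comNzRingType) (n : nat).

Definition horner_last (q : {poly {mpoly R[n]}}) : {mpoly R[n.+1]} :=
  (map_poly (@mwiden n R) q).['X_ord_max].

Lemma muniX_last : muni ('X_ord_max : {mpoly R[n.+1]}) = 'X.
Proof.
rewrite /muni mmapX mmap1U; case: splitP => //= j jE.
by have := ltn_ord j; rewrite -jE ltnn.
Qed.

Lemma muniX_widen i :
  muni ('X_(widen_ord (leqnSn n) i) : {mpoly R[n.+1]}) = ('X_i)%:P.
Proof.
rewrite /muni mmapX mmap1U; case: splitP => [j jE|j].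
  by congr ('X__)%:P; apply/val_inj; rewrite /= -jE.
by rewrite ord1 /= addn0 => /eqP; rewrite ltn_eqF.
Qed.

Lemma ord_lastP (i : 'I_n.+1) : i = ord_max \/ exists j, i = widen_ord (leqnSn n) j.
Proof.
case: (unliftP ord_max i) => [j ->|->]; [right; exists j|by left].
by apply: val_inj; rewrite /= /bump leqNgt ltn_ord.
Qed.

Lemma muniK : cancel (@muni n R) horner_last.
Proof.
pose wm : {rmorphism _ -> _} := @mwiden n R.
move=> p; have := @mpoly_rmorph_eq _ _ _
  (horner_eval ('X_ord_max : {mpoly R[n.+1]}) \o map_poly wm \o @muni n R) idfun.
apply => [c|i] /=; first by rewrite /horner_eval muniC map_polyC hornerC /= mwidenC.
have [->|[j ->]] := ord_lastP i.
  by rewrite /horner_eval muniX_last map_polyX hornerX.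
by rewrite /horner_eval muniX_widen map_polyC hornerC /= mwidenX mnmwiden1.
Qed.

Lemma comp_mwiden r (y : n.-tuple {mpoly R[r]}) x p :
  mwiden p \mPo [tuple of rcons y x] = p \mPo y.
Proof.
apply: (@mpoly_rmorph_eq _ _ _
  (comp_mpoly [tuple of rcons y x] \o @mwiden n R) (comp_mpoly y)) => [c|i] /=.
  by rewrite mwidenC !comp_mpolyC.
by rewrite mwidenX mnmwiden1 !comp_mpolyXU nth_rcons size_tuple /= ltn_ord.
Qed.

(** Opens the way to an induction on the degree in the last variable, which is sent to [x]. *)
Lemma comp_mpoly_rcons r (y : n.-tuple {mpoly R[r]}) x p :
  p \mPo [tuple of rcons y x] = (map_poly (comp_mpoly y) (muni p)).[x].
Proof.
rewrite -{1}(muniK p) /horner_last -horner_map /=.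
rewrite comp_mpolyXU /= nth_rcons size_tuple ltnn eqxx -map_poly_comp.
by congr (_.[x]); apply: eq_map_poly => q /=; rewrite comp_mwiden.
Qed.

End Univariate.

(** * Algebraic dependence and lengths of chains of primes *)

Section AlgebraicDependence.
Variable k : fieldType.

Lemma mcoeff_deg_bound n (p : {mpoly k[n]}) (u : 'X_{1..n}) i :
  (msize p <= u i)%N -> p@_u = 0.
Proof.
move=> ui; apply: memN_msupp_eq0; apply/negP => /msize_mdeg_lt.
by rewrite ltnNge (leq_trans ui) // mdegE (bigD1 i) //= leq_addr.
Qed.

Lemma msizeM_leq n (p q : {mpoly k[n]}) d e :
  (msize p <= d.+1)%N -> (msize q <= e.+1)%N -> (msize (p * q)%R <= (d + e).+1)%N.
Proof.
have [->|p0] := eqVneq p 0; first by rewrite mul0r msize0.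
have [->|q0] := eqVneq q 0; first by rewrite mulr0 msize0.
move=> pd qe; rewrite msizeM //.
move: pd qe; move: (msize p) (msize q) => a b; lia.
Qed.

Lemma msize_prod_exp n r (y : r.-tuple {mpoly k[n]}) N d (b : 'I_r -> nat) :
  (forall i, msize (tnth y i) <= d.+1)%N -> (forall i, b i <= N)%N ->
  (msize (\prod_(i < r) tnth y i ^+ b i)%R <= (r * (N * d)).+1)%N.
Proof.
move=> yd bN; rewrite -[X in (X * _)%N](card_ord r) -sum_nat_const.
elim/big_rec2: _ => [|i e p _ IH]; first by rewrite msize1.
apply: msizeM_leq => //.
apply: leq_trans (_ : (b i * d).+1 <= _)%N; last by rewrite ltnS leq_mul2r bN orbT.
elim: (b i) => [|c IHc]; first by rewrite expr0 msize1.
by rewrite exprS mulSn msizeM_leq.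
Qed.

(* Linear algebra: the N^r monomials of degree less than N in each of the
   y_i lie in a space of dimension (D N)^n, so they are dependent for N > D^n. *)
Lemma mpoly_dependent n r (y : r.-tuple {mpoly k[n]}) :
  (n < r)%N -> exists2 p : {mpoly k[r]}, p != 0 & p \mPo y = 0.
Proof.
move=> nr.
pose d := (\max_(i < r) msize (tnth y i))%N.
have yd i : (msize (tnth y i) <= d.+1)%N.
  exact/leqW/(@leq_bigmax _ (fun i => msize (tnth y i))).
pose D := (r * d).+1; pose N := (D ^ n).+1.
pose M := (D * N)%N.
pose I := {ffun 'I_r -> 'I_N}; pose J := {ffun 'I_n -> 'I_M}.
pose mI (b : I) : 'X_{1..r} := [multinom (b i : nat) | i < r].
pose mJ (b : J) : 'X_{1..n} := [multinom (b i : nat) | i < n].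
pose P (b : I) := 'X_[mI b] \mPo y.
have Psize b : (msize (P b) <= M)%N.
  rewrite /P comp_mpolyX; apply: leq_trans (_ : (r * (N.-1 * d)).+1 <= _)%N.
    by apply: msize_prod_exp => // i; rewrite mnmE -ltnS ltn_ord.
  by rewrite /M /D /= mulnCA mulSn mulnC addSn ltnS mulnS; nia.
pose A : 'M[k]_(#|I|, #|J|) := \matrix_(i, j) (P (enum_val i))@_(mJ (enum_val j)).
have : kermx A != 0.
  rewrite -mxrank_eq0 mxrank_ker subn_eq0 -ltnNge (leq_ltn_trans (rank_leq_col _)) //.
  rewrite !card_ffun !card_ord (@leq_trans (N ^ n.+1)) ?leq_pexp2l //.
  by rewrite /M expnMn expnS ltn_mul2r expn_gt0 /= ltnSn.
case/rowV0Pn => c /sub_kermxP cA c0.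
exists (\sum_i c 0 i *: 'X_[mI (enum_val i)]).
  apply: contraNneq c0 => p0; apply/eqP/rowP => i; rewrite mxE.
  have := congr1 (mcoeff (mI (enum_val i))) p0; rewrite mcoeff0 raddf_sum /=.
  rewrite (bigD1 i) //= mcoeffZ mcoeffX eqxx mulr1 big1 ?addr0 // => j ji.
  rewrite mcoeffZ mcoeffX; case: eqP => [/mnmP e|]; rewrite ?mulr0 //.
  case/eqP: ji; apply/enum_val_inj/ffunP => l; apply: val_inj.
  by have := e l; rewrite !mnmE.
rewrite (raddf_sum (comp_mpoly y)); apply/mpolyP => u; rewrite mcoeff0 raddf_sum /=.
(* A monomial with an exponent at least [M] is not indexed by [J], but by [Psize] it occurs in none
   of the [P b]. *)
have [uM|] := boolP [forall i, u i < M]%N; last first.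
  case/forallPn => i; rewrite -leqNgt => ui; rewrite big1 // => j _.
  by rewrite comp_mpolyZ mcoeffZ (mcoeff_deg_bound (leq_trans (Psize _) ui)) mulr0.
pose b : J := [ffun i => Ordinal (forallP uM i)].
have -> : u = mJ b by apply/mnmP => i; rewrite mnmE ffunE.
have := congr1 (fun w : 'rV_ _ => w 0 (enum_rank b)) cA; rewrite !mxE; apply: etrans.
by apply: eq_bigr => i _; rewrite !mxE enum_rankK comp_mpolyZ mcoeffZ.
Qed.

Definition alg_indep n r (Q : {pred {mpoly k[n]}}) (y : r.-tuple {mpoly k[n]}) :=
  forall p, p \mPo y \in Q -> p = 0.

(** Write a relation as q(y, x) x + c(y). As x lies in Q', so does c(y), whence c = 0 by
    independence modulo Q'. Then q(y, x) x lies in the prime Q, which does not contain x, so q is a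
    relation of smaller degree in x. *)
Lemma alg_indep_rcons n r (Q Q' : {pred {mpoly k[n]}}) x (y : r.-tuple {mpoly k[n]}) :
  prime_ideal Q -> idealr_closed Q' -> {subset Q <= Q'} ->
  x \notin Q -> x \in Q' -> alg_indep Q' y -> alg_indep Q [tuple of rcons y x].
Proof.
move=> [Qi Qp] Q'i QQ' xQ xQ' yi p; rewrite comp_mpoly_rcons.
suff muni0 : forall q, (map_poly (comp_mpoly y) q).[x] \in Q -> q = 0.
  by move=> /muni0 q0; rewrite -(muniK p) q0 /horner_last map_poly0 horner0.
elim/poly_ind => // q c IH.
rewrite rmorphD rmorphM /= map_polyX map_polyC /= hornerMXaddC => h.
have [Q0 _ Qc] := Qi; have [_ _ Q'c] := Q'i.
have c0 : c = 0.
  apply: yi; rewrite -[c \mPo y](addKr ((map_poly (comp_mpoly y) q).[x] * x)).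
  by rewrite -mulNr; apply: Q'c => //; apply: QQ'.
move: h; rewrite c0 comp_mpoly0 addr0 => /Qp; rewrite (negbTE xQ) orbF => /IH ->.
by rewrite mul0r add0r.
Qed.

Lemma chain_alg_indep n (P : {pred {mpoly k[n]}}) h Q r (y : r.-tuple {mpoly k[n]}) :
  prime_chain P h Q -> alg_indep P y -> (h + r <= n)%N.
Proof.
move=> [Qp Qs QP] yi.
(* Going down from the top of the chain, each step adjoins one element; [Q 0] is reached with h + r
   of them. *)
suff chain j : (j <= h)%N -> exists z : (j + r).-tuple {mpoly k[n]},
    alg_indep (Q (h - j)%N) z.
  have [z zi] := chain _ (leqnn h); rewrite leqNgt; apply/negP => hr.
  have [p /eqP p0 pz] := mpoly_dependent z hr; apply/p0/zi.
  by rewrite pz; have [[]] := Qp _ (leq_subr h h).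
elim: j => [_|j IH jh].
  by exists y => p; rewrite subn0 QP; apply: yi.
have [z zi] := IH (ltnW jh).
have hj : (h - j = (h - j.+1).+1)%N by lia.
have [|QQ /existsNP[x /not_implyP[xQ' /negP xQ]]] := Qs (h - j.+1)%N; first by lia.
rewrite addSn; exists [tuple of rcons z x].
apply: (alg_indep_rcons (Qp _ _) _ QQ) => //; rewrite -?hj ?leq_subr //.
by have [] := Qp (h - j)%N (leq_subr _ _).
Qed.
End AlgebraicDependence.

(** * Generated ideals and prime ideals *)

Section Ideals.
Variable A : comNzRingType.
Implicit Types (S : set A) (J P : {pred A}).

Lemma mem_ideal_gen S x : S x -> x \in ideal_gen S.
Proof.
move=> Sx; apply/asboolP; exists [:: (1, x)]; split => [p|].
  by rewrite inE => /eqP ->.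
by rewrite big_seq1 mul1r.
Qed.

Lemma ideal_gen_sub S J : idealr_closed J -> (forall x, S x -> x \in J) ->
  {subset ideal_gen S <= J}.
Proof.
move=> [J0 _ Jc] SJ x /asboolP[s [sS ->]]; rewrite big_seq.
elim/big_rec: _ => // p y /sS /SJ pJ yJ; exact: Jc.
Qed.

(** Unlike [ideal_gen_sub], this also covers the case where [S'] generates the unit ideal, which
    [idealr_closed] excludes. *)
Lemma ideal_gen_mono S S' : (forall x, S x -> x \in ideal_gen S') ->
  {subset ideal_gen S <= ideal_gen S'}.
Proof.
move=> SS' x /asboolP[s [sS ->]]; rewrite big_seq.
elim/big_rec: _ => [|p y /sS /SS' /asboolP[t [tS tE]] /asboolP[w [wS ->]]].
  by apply/asboolP; exists [::]; rewrite big_nil.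
apply/asboolP; exists ([seq (p.1 * q.1, q.2) | q <- t] ++ w); split => [q|].
  by rewrite mem_cat => /orP[/mapP[q' /tS q'S ->]|/wS].
rewrite big_cat big_map tE mulr_sumr; congr (_ + _).
by apply: eq_bigr => q _; rewrite mulrA.
Qed.

Lemma idealr_gen S : 1 \notin ideal_gen S -> idealr_closed (ideal_gen S).
Proof.
split=> // [|a u v /asboolP[s [sS ->]] /asboolP[t [tS ->]]]; apply/asboolP.
  by exists [::]; rewrite big_nil.
exists ([seq (a * p.1, p.2) | p <- s] ++ t); split => [p|].
  by rewrite mem_cat => /orP[/mapP[q /sS qS ->] //|/tS].
rewrite big_cat big_map /= mulr_sumr; congr (_ + _).
by apply: eq_bigr => p _; rewrite mulrA.
Qed.

Lemma ideal_gen_nil x : x \in ideal_gen [set` [::] : seq A] -> x = 0.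
Proof.
case/asboolP => -[|p s] [sS ->]; first by rewrite big_nil.
by have := sS p (mem_head p s); rewrite /= in_nil.
Qed.

Lemma ideal_gen1P a x :
  reflect (exists b, x = b * a) (x \in ideal_gen [set` [:: a] : seq A]).
Proof.
apply: (iffP idP) => [/asboolP[s [sS ->]]|[b ->]].
  exists (\sum_(p <- s) p.1); rewrite mulr_suml !big_seq.
  by apply: eq_bigr => p /sS; rewrite /= inE => /eqP ->.
apply/asboolP; exists [:: (b, a)]; rewrite big_seq1; split => // p.
by rewrite inE => /eqP -> /=; rewrite inE.
Qed.

Lemma prime_ideal_ker (D : idomainType) (f : {rmorphism A -> D}) :
  prime_ideal [pred a | f a == 0].
Proof.
split; last by move=> u v; rewrite !inE rmorphM mulf_eq0.
split; rewrite ?inE ?rmorph0 // ?rmorph1 ?oner_eq0 // => a u v.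
by rewrite !inE rmorphD rmorphM => /eqP -> /eqP ->; rewrite mulr0 addr0.
Qed.

(** Only the top prime is replaced. The last inclusion stays strict: if [P'] were contained in the
    prime below, then so would be [P]. *)
Lemma prime_chain_sub P P' h Q : prime_chain P h Q -> prime_ideal P' ->
  {subset P <= P'} -> exists Q', prime_chain P' h Q'.
Proof.
move=> [Qp Qs QP] P'p PP'; exists (fun i => if (i < h)%N then Q i else P').
split=> [i _|i ih|x]; last by rewrite ltnn.
  by case: ifP => // /ltnW/Qp.
rewrite ih; case: ltnP => [/Qs|hi]; first by have := Qs i ih.
have e : i.+1 = h by apply/eqP; rewrite eqn_leq ih hi.
have [sub nsub] := Qs i ih; rewrite e in sub nsub.
split=> [x /sub|P'Q]; first by rewrite QP => /PP'.
by apply: nsub => x; rewrite QP => /PP'/P'Q.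
Qed.

End Ideals.

(** * Images of ideals in a quotient ring *)

Section QuotientIdeal.
Variables (A : comNzRingType) (I : idealr A).
Local Notation R := {ideal_quot I}.
Local Open Scope quotient_scope.
Local Notation "\p" := (\pi_R : A -> R).

(** The image of J in the quotient; when J contains I, membership does not depend on the
    representative, by [mem_quot_ideal]. *)
Definition quot_ideal (J : {pred A}) : {pred R} := [pred z | repr z \in J].

Variable J : {pred A}.
Hypothesis IJ : {subset I <= J}.

Lemma piq_eq x y : (\pi_R x = \pi_R y) <-> (x - y \in I).
Proof. by rewrite Quotient.idealrBE; split => [->|/eqP]. Qed.

Lemma mem_quot_ideal : idealr_closed J ->
  forall x, (\pi_R x \in quot_ideal J) = (x \in J).
Proof.
move=> [_ _ Jc] x; rewrite inE /=.
have rx : repr (\pi_R x) - x \in I by apply/piq_eq; rewrite reprK.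
apply/idP/idP => h.
  rewrite -[x](subKr (repr (\pi_R x))) addrC -mulN1r; apply: Jc => //; exact: IJ.
rewrite -[repr _](subrK x) -[_ - _]mul1r; apply: Jc => //; exact: IJ.
Qed.

Lemma idealr_quot : idealr_closed J -> idealr_closed (quot_ideal J).
Proof.
move=> Ji; have qE := mem_quot_ideal Ji; have [J0 J1 Jc] := Ji.
split=> [||a u v]; first by rewrite -(rmorph0 \p) qE.
  by rewrite -(rmorph1 \p) qE.
rewrite -[a]reprK -[u]reprK -[v]reprK -(rmorphM \p) -(rmorphD \p) !qE; exact: Jc.
Qed.

Lemma prime_quot : prime_ideal J -> prime_ideal (quot_ideal J).
Proof.
move=> [Ji Jp]; have qE := mem_quot_ideal Ji; split; first exact: idealr_quot.
move=> u v; rewrite -[u]reprK -[v]reprK -(rmorphM \p) !qE; exact: Jp.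
Qed.

End QuotientIdeal.

Arguments quot_ideal {A} I J _.

(** * A criterion for depth at most one *)

Section Depth.
Variables (R : comNzRingType) (n : nat) (v c : 'I_n -> R).
Hypothesis vcC : forall i j, v i * c j = v j * c i.

(* The (c i) define an element of the first Koszul cohomology group of the v i,
   which vanishes when the ideal of the v i contains a regular sequence of
   length two. *)
Lemma regular_sequence_proportional (s : seq R) : regular_sequence s ->
  (forall f, f \in s -> exists p : 'I_n -> R, f = \sum_i p i * v i) ->
  (2 <= size s)%N -> forall i, exists h, c i = v i * h.
Proof.
case: s => [|f1 [|f2 s]] // [reg _] span _ i.
have [p1 f1E] := span f1 (mem_head _ _).
have [|p2 f2E] := span f2; first by rewrite !inE eqxx orbT.
(* If w denotes the common fraction c_j / v_j, the sum of the p_l c_l plays the role of w f. *)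
have swap f (p : 'I_n -> R) j :
    f = \sum_l p l * v l -> f * c j = v j * \sum_l p l * c l.
  move=> ->; rewrite mulr_suml mulr_sumr; apply: eq_bigr => l _.
  by rewrite -mulrA vcC mulrCA.
have reg1 x : f1 * x = 0 -> x = 0.
  move=> fx; apply/ideal_gen_nil/(reg 0%N) => //=; rewrite fx.
  by apply/asboolP; exists [::]; rewrite big_nil.
have /ideal_gen1P[h g1E] :
    \sum_l p1 l * c l \in ideal_gen [set` [:: f1] : seq R].
  apply: (reg 1%N) => //=; apply/ideal_gen1P; exists (\sum_l p2 l * c l).
  rewrite mulr_sumr f1E mulr_sumr; apply: eq_bigr => j _.
  by rewrite mulrCA (swap _ _ _ f2E) [RHS]mulrC -mulrA.
exists h; apply/eqP; rewrite -subr_eq0; apply/eqP/reg1.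
by rewrite mulrBr (swap _ _ _ f1E) g1E mulrA [f1 * _]mulrC subrr.
Qed.

(** The chain forces the height of [P], hence its depth in the Cohen-Macaulay case, to be at least
    2; the resulting regular sequence would make [c i] a multiple of [v i]. *)
Lemma depth_one_not_cohen_macaulay (P : {pred R}) Q i :
  maximal_ideal P -> prime_chain P 2 Q ->
  (forall f, f \in P -> exists p : 'I_n -> R, f = \sum_j p j * v j) ->
  (forall h, c i != v i * h) -> ~ cohen_macaulay R.
Proof.
move=> Pmax chain span ci [_ /(_ P Pmax)[d [[[s [reg sP sd]] _] [_ ht]]]].
have s2 : (2 <= size s)%N by rewrite sd; apply: (ht 2 Q).
have sspan f : f \in s -> exists p : 'I_n -> R, f = \sum_j p j * v j.
  by move=> /sP/span.
have [h hE] := regular_sequence_proportional reg sspan s2 i.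
by have /eqP := ci h.
Qed.
End Depth.

(** * Maximal ideals and chains of primes in a quotient ring *)

Section QuotientChains.
Variables (A : comNzRingType) (I : idealr A).
Local Open Scope quotient_scope.
Local Notation R := {ideal_quot I}.
Local Notation "\p" := (\pi_R : A -> R).

Lemma maximal_quot (J : {pred A}) : {subset I <= J} ->
  maximal_ideal J -> maximal_ideal (quot_ideal I J).
Proof.
move=> IJ [Ji Jmax]; split=> [|K [K0 K1 Kc] JK z zK]; first exact: idealr_quot.
have qE := mem_quot_ideal IJ Ji.
rewrite -[z]reprK qE; apply: (Jmax [pred x | \pi_R x \in K]) => /= [|x xJ|].
- split; rewrite ?inE ?(rmorph0 \p) ?(rmorph1 \p) // => a u v uK vK.
  by rewrite inE (rmorphD \p) (rmorphM \p); apply: Kc.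
- by rewrite inE; apply: JK; rewrite qE.
- by rewrite inE reprK.
Qed.

Lemma prime_chain_quot P h Q : (forall i, {subset I <= Q i}) ->
  prime_chain P h Q -> prime_chain (quot_ideal I P) h (fun i => quot_ideal I (Q i)).
Proof.
move=> IQ [Qp Qs QP]; split=> [i ih|i ih|z]; last by rewrite !inE QP.
  exact/prime_quot/Qp.
have [sub nsub] := Qs i ih; split=> [z|h']; first by rewrite !inE; apply: sub.
have [Qi _] := Qp i (ltnW ih); have [Qi' _] := Qp i.+1 ih.
apply: nsub => x xQ; rewrite -(mem_quot_ideal (IQ i) Qi); apply: h'.
by rewrite (mem_quot_ideal (IQ i.+1) Qi').
Qed.

End QuotientChains.

(** * The ideal of the origin, and linear coefficients of lattice ideals *)

Section Polynomials.
Variables (k : fieldType) (n : nat).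
Local Notation A := {mpoly k[n]}.
Local Open Scope quotient_scope.

(** The projection modulo J and its composite with the substitution are two morphisms that agree on
    the variables. *)
Lemma comp_mpoly_congr (J : idealr A) (y : n.-tuple A) :
  (forall i, 'X_i - tnth y i \in J) -> forall p, p - (p \mPo y) \in J.
Proof.
move=> yJ p; apply/piq_eq.
pose R := {ideal_quot J}; pose f : {rmorphism A -> R} := \pi_R.
apply: (mpoly_rmorph_eq (f := f) (g := f \o comp_mpoly y)) => [c|i] /=.
  by rewrite comp_mpolyC.
by rewrite comp_mpolyX_tnth; apply/piq_eq.
Qed.

Definition origin : {pred A} := [pred p : A | p.@[fun=> 0] == 0].

Lemma maximal_origin : maximal_ideal origin.
Proof.
have [Ji _] := prime_ideal_ker (meval (fun=> 0 : k) : {rmorphism A -> k}).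
split=> // K [K0 K1 Kc] JK z zK; apply: contraNT K1 => z0.
have cK : (z.@[fun=> 0])%:MP \in K.
  rewrite -[_%:MP](subKr z) addrC -mulN1r; apply: Kc => //; apply: JK.
  by rewrite inE mevalB mevalC subrr.
rewrite -[1]addr0 -[1](_ : (z.@[fun=> 0])^-1%:MP * (z.@[fun=> 0])%:MP = _).
  exact: Kc.
by rewrite -mpolyCM mulVf.
Qed.

Lemma origin_span p : p \in origin -> exists q : 'I_n -> A, p = \sum_i q i * 'X_i.
Proof.
move=> p0; suff [q {1}->] : exists q : 'I_n -> A,
    p = p.@[fun=> 0]%:MP + \sum_i q i * 'X_i.
  by exists q; rewrite (eqP p0) mpolyC0 add0r.
elim/mpolyind: p {p0} => [|c u p _ _ [q pE]].
  by exists (fun=> 0); rewrite meval0 mpolyC0 add0r big1 // => i _; rewrite mul0r.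
have [->|/eqP/mnmP u0] := eqVneq u 0%MM.
  exists q; rewrite {1}pE mevalD mevalZ mpolyX0 meval1 mulr1 mpolyCD addrA.
  by rewrite -mul_mpolyC mulr1.
have [i ui] : exists i, (0 < u i)%N.
  apply: contra_notP u0 => /forallNP u0 i; rewrite mnm0E.
  by apply/eqP; rewrite -leqn0 leqNgt; apply/negP/u0.
exists (fun j => q j + (if j == i then c *: 'X_[u - U_(i)] else 0)).
have Xu0 : ('X_[u] : A).@[fun=> 0] = 0.
  by rewrite mevalX (bigD1 i) //= expr0n eqn0Ngt ui mul0r.
rewrite {1}pE mevalD mevalZ Xu0 mulr0 add0r.
rewrite addrCA; congr (_ + _).
under [RHS]eq_bigr do rewrite mulrDl.
rewrite big_split /= addrC; congr (_ + _).
rewrite (bigD1 i) //= eqxx big1 ?addr0 => [|j /negbTE ->]; last by rewrite mul0r.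
rewrite -scalerAl -mpolyXD; congr (_ *: 'X_[_]); apply/mnmP => j.
by rewrite mnmDE mnmBE mnm1E; case: eqP => [<-|_] /=; rewrite ?subn0 ?addn0 ?subnK.
Qed.

(** The coefficient of X_i is the constant term of the derivative, so this is the Leibniz rule. *)
Lemma mcoeff_linM (p q : A) i :
  (p * q)@_U_(i) = p@_U_(i) * q@_0%MM + p@_0%MM * q@_U_(i).
Proof.
have cE (f : A) : f@_U_(i) = (f^`M(i))@_0%MM.
  by rewrite mcoeff_deriv mnm0E add0m mulr1n.
by rewrite !cE mderivM mcoeffD !rmorphM.
Qed.

(** In each binomial generator the two terms cancel both in the constant coefficient and in that of
    X_i; by [mcoeff_linM] the multiples of a generator have no X_i term either. *)
Lemma lattice_ideal_coef (L : set 'rV[int]_n) i :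
  (forall a b : 'X_{1..n}, L (\row_i ((a i)%:Z - (b i)%:Z)) ->
     (a == 0%MM) = (b == 0%MM) /\ (a == U_(i)%MM) = (b == U_(i)%MM)) ->
  forall f, f \in lattice_ideal k L -> f@_U_(i) = 0.
Proof.
move=> Li f /asboolP[s [sS ->]]; rewrite raddf_sum big_seq big1 // => p /sS.
move=> [a [b [/Li[e0 e1] pE]]]; rewrite /= mcoeff_linM pE !mcoeffB !mcoeffX.
by rewrite e0 e1 !subrr !mulr0 addr0.
Qed.

Lemma lattice_ideal_mono (L L' : set 'rV[int]_n) : L `<=` L' ->
  {subset lattice_ideal k L <= lattice_ideal k L'}.
Proof.
move=> LL'; apply: ideal_gen_mono => x [a [b [ab ->]]].
by apply: mem_ideal_gen; exists a, b; split => //; apply: LL'.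
Qed.

End Polynomials.

(** * The lattices: rank, saturation, positivity *)

Section Example.
Variables (m' r : nat).
Local Notation m := m'.+2.
Local Notation n := m'.+4.

(* The variable X_i has degree (weight_x i, weight_y i; weight_t i) in
   N^2 x Z/2: the degrees are (1,0;0), (0,1;0), (r+1,0;1), (0,1;1), ..., (0,1;1). *)
Definition weight_x (i : nat) : nat := nth 0%N [:: 1; 0; r.+1]%N i.
Definition weight_y (i : nat) : nat := nth 1%N [:: 0; 1; 0]%N i.
Definition weight_t (i : nat) : nat := nth 1%N [:: 0; 0; 1]%N i.

Definition lin (w : nat -> nat) (u : 'rV[int]_n) : int := \sum_(i < n) (w i)%:Z * u 0 i.

Definition big_lattice : set 'rV[int]_n :=
  [set u | lin weight_x u = 0 /\ lin weight_y u = 0].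

Definition small_lattice : set 'rV[int]_n :=
  [set u | big_lattice u /\ exists q, lin weight_t u = q *+ 2].

Lemma lin0 w : lin w 0 = 0.
Proof. by rewrite /lin big1 // => i _; rewrite mxE mulr0. Qed.

Lemma linB w u v : lin w (u - v) = lin w u - lin w v.
Proof. by rewrite /lin -sumrB; apply: eq_bigr => i _; rewrite !mxE mulrBr. Qed.

Lemma linMn w u c : lin w (u *+ c) = lin w u *+ c.
Proof. by rewrite /lin -sumrMnl; apply: eq_bigr => i _; rewrite mulmxnE mulrnAr. Qed.

Definition tail_ord (i : 'I_m'.+1) : 'I_n := lift ord0 (lift ord0 (lift ord0 i)).

Lemma ord4P (i : 'I_n) : [\/ i = 0, i = lift ord0 0, i = lift ord0 (lift ord0 0)
  | exists j, i = tail_ord j].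
Proof.
case: (unliftP ord0 i) => [i1 ->|->]; last exact: Or41.
case: (unliftP ord0 i1) => [i2 ->|->]; last exact: Or42.
case: (unliftP ord0 i2) => [j ->|->]; last exact: Or43.
by apply: Or44; exists j.
Qed.

Lemma linE w u : lin w u = (w 0)%:Z * u 0 0 + (w 1)%:Z * u 0 (lift ord0 0) +
  (w 2)%:Z * u 0 (lift ord0 (lift ord0 0)) +
  \sum_(i < m'.+1) (w i.+3)%:Z * u 0 (tail_ord i).
Proof. by rewrite /lin 3!big_ord_recl !addrA. Qed.

Lemma lin_xE u : lin weight_x u = u 0 0 + r.+1%:Z * u 0 (lift ord0 (lift ord0 0)).
Proof.
rewrite linE big1 ?addr0 => [|i _]; last by rewrite /weight_x nth_default // mul0r.
by rewrite mul0r addr0 mul1r.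
Qed.

Lemma lin_yE u : lin weight_y u = u 0 (lift ord0 0) + \sum_i u 0 (tail_ord i).
Proof.
rewrite linE !mul0r add0r addr0 mul1r; congr (_ + _).
by apply: eq_bigr => i _; rewrite /weight_y nth_default // mul1r.
Qed.

Lemma lin_tE u :
  lin weight_t u = u 0 (lift ord0 (lift ord0 0)) + \sum_i u 0 (tail_ord i).
Proof.
rewrite linE !mul0r !add0r mul1r; congr (_ + _).
by apply: eq_bigr => i _; rewrite /weight_t nth_default // mul1r.
Qed.

Lemma weight_gt0 (i : 'I_n) : (0 < weight_x i + weight_y i)%N.
Proof.
have [->|->|->|[j ->]] := ord4P i => //.
by rewrite /weight_y [nth 1%N _ _]nth_default ?addn1.
Qed.

Lemma lattice_small : lattice small_lattice.
Proof.
split=> [|u v [[ux uy] [p ut]] [[vx vy] [q vt]]].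
  by split; [split; rewrite lin0|exists 0; rewrite lin0].
split; first by split; rewrite linB ?ux ?vx ?uy ?vy subrr.
by exists (p - q); rewrite linB ut vt mulrnBl.
Qed.

Lemma saturation_small : saturation small_lattice = big_lattice.
Proof.
apply/seteqP; split=> [u [c c0 [[ux uy] _]]|u [ux uy]].
  by split; apply/eqP; [move: ux|move: uy]; rewrite linMn => /eqP;
     rewrite mulrn_eq0 eqn0Ngt c0.
(* Doubling makes the Z/2 component vanish. *)
exists 2%N => //; split; first by split; rewrite linMn ?ux ?uy mul0rn.
by exists (lin weight_t u); rewrite linMn.
Qed.

(** Every variable has positive total degree in x and y, so a vector with nonnegative entries and
    total degree 0 is 0. *)
Lemma positive_small : positive small_lattice.
Proof.
apply/seteqP; split=> [u [[[ux uy] _] u0]|u ->]; last first.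
  by split; [case: lattice_small|move=> i; rewrite mxE].
have : \sum_(i < n) (weight_x i + weight_y i)%N%:Z * u 0 i =
    lin weight_x u + lin weight_y u.
  by rewrite /lin -big_split; apply: eq_bigr => i _; rewrite PoszD mulrDl.
rewrite ux uy addr0 => /eqP; rewrite psumr_eq0 => [/allP ui|i _];
  last by rewrite mulr_ge0.
apply/rowP => i; have := ui i (mem_index_enum i); rewrite mulf_eq0 mxE.
by rewrite eqz_nat -leqn0 leqNgt weight_gt0 => /eqP.
Qed.

(* The exponent of X_2 / X_0^(r+1). *)
Definition witness : 'rV[int]_n :=
  \row_i nth 0 [:: - r.+1%:Z; 0; 1] i.

Lemma witness_big : big_lattice witness.
Proof.
split; rewrite ?lin_xE ?lin_yE !mxE /=; first by rewrite mulr1 addNr.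
by rewrite add0r big1 // => i _; rewrite mxE nth_default.
Qed.

Lemma small_not_saturated : ~ saturated small_lattice.
Proof.
rewrite /saturated saturation_small => e.
have : small_lattice witness by rewrite e; apply: witness_big.
move=> [_ [q]]; rewrite lin_tE !mxE /= big1 ?addr0 => [|i _]; last first.
  by rewrite mxE nth_default.
lia.
Qed.

Lemma small_witness2 : small_lattice (witness *+ 2).
Proof.
have [wx wy] := witness_big; split; first by split; rewrite linMn ?wx ?wy mul0rn.
by exists (lin weight_t witness); rewrite linMn.
Qed.

(** Row 0 is the exponent of (X_2 / X_0^(r+1))^2, and row i > 0 that of X_2 X_(i+2) / (X_0^(r+1)
    X_1). *)
Definition small_basis : 'M[int]_(m, n) :=
  \matrix_(i, j) match nat_of_ord j with
    | 0 => - r.+1%:Z * (1 + (i == 0 :> nat))%:Z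
    | 1 => - (i != 0 :> nat)%:Z
    | 2 => (1 + (i == 0 :> nat))%:Z
    | j.+3 => (i == j.+1 :> nat)%:Z
    end.

Lemma small_basisE (c : 'rV[int]_m) (t := \sum_(i < m'.+1) c 0 (lift ord0 i))
    (u := c *m small_basis) :
  [/\ u 0 0 = - r.+1%:Z * (c 0 0 *+ 2 + t), u 0 (lift ord0 0) = - t,
      u 0 (lift ord0 (lift ord0 0)) = c 0 0 *+ 2 + t
    & forall i, u 0 (tail_ord i) = c 0 (lift ord0 i)].
Proof.
rewrite {}/u {}/t.
split=> [|||j]; rewrite mxE big_ord_recl !mxE /=.
- rewrite mulrDr mulr_sumr; congr (_ + _).
    by rewrite mulrC -mulrA; congr (_ * _); rewrite -[LHS]/(2%:Z * c 0 0); lia.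
  by apply: eq_bigr => i _; rewrite !mxE /= mulr1 mulrC.
- rewrite mulr0 add0r -sumrN; apply: eq_bigr => i _; rewrite !mxE /=.
  by rewrite mulrN1.
- congr (_ + _); first by rewrite -[LHS]/(c 0 0 * 2%:Z); lia.
  by apply: eq_bigr => i _; rewrite !mxE /= mulr1.
- rewrite mulr0 add0r (bigD1 j) //= big1 ?addr0 => [|i ij]; rewrite !mxE /=.
    by rewrite eqxx mulr1.
  by rewrite eqSS (inj_eq val_inj) (negbTE ij) mulr0.
Qed.

Lemma rank_small : lattice_rank small_lattice m.
Proof.
exists small_basis; split=> [c c0|].
  have [_ _ c2 ct] := small_basisE c; rewrite c0 !mxE in c2.
  have ct0 i : c 0 (lift ord0 i) = 0 by rewrite -ct c0 mxE.
  apply/rowP => i; rewrite mxE; case: (unliftP ord0 i) => [j ->|->] //.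
  have c00 : c 0 0 = 0 by move: c2; rewrite big1 // addr0; lia.
  exact: c00.
apply/seteqP; split=> [u [[ux uy] [q ut]]|_ [c _ <-]]; last first.
  have [u0 u1 u2 u3] := small_basisE c.
  split; first by split; rewrite ?lin_xE ?lin_yE ?u0 ?u1 ?u2
    ?(eq_bigr _ (fun i _ => u3 i)) ?mulNr addNr.
  exists (c 0 0 + \sum_(i < m'.+1) c 0 (lift ord0 i)).
  by rewrite lin_tE u2 (eq_bigr _ (fun i _ => u3 i)) mulrnDl -addrA -mulr2n.
(* The columns from 3 on determine all coordinates but the first. With s the sum of these, column 2
   requires 2 c_0 + s = u_2, where u_2 + s = 2 q, so c_0 = q - s. *)
pose c : 'rV[int]_m := \row_i if unlift ord0 i is Some j then u 0 (tail_ord j)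
  else q - \sum_i u 0 (tail_ord i).
have c0 : c 0 0 = q - \sum_i u 0 (tail_ord i) by rewrite mxE unlift_none.
have c1 i : c 0 (lift ord0 i) = u 0 (tail_ord i) by rewrite mxE liftK.
have [v0 v1 v2 v3] := small_basisE c.
rewrite c0 (eq_bigr _ (fun i _ => c1 i)) in v0 v1 v2.
rewrite lin_xE in ux; rewrite lin_yE in uy; rewrite lin_tE in ut.
set s := \sum_i _ in v0 v1 v2 uy ut.
have u2 : (q - s) *+ 2 + s = u 0 (lift ord0 (lift ord0 0)) by lia.
exists c => //; apply/rowP => i; have [->|->|->|[j ->]] := ord4P i.
- by rewrite v0 u2 mulNr; apply/eqP; rewrite eq_sym -addr_eq0 ux.
- by rewrite v1; apply/eqP; rewrite eq_sym -addr_eq0 uy.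
- by rewrite v2.
- by rewrite v3 c1.
Qed.


(** * Degrees of monomials *)

Definition deg (w : nat -> nat) (a : 'X_{1..n}) : nat := \sum_(i < n) w i * a i.

Lemma lin_deg w (a b : 'X_{1..n}) :
  lin w (\row_i ((a i)%:Z - (b i)%:Z)) = (deg w a)%:Z - (deg w b)%:Z.
Proof.
rewrite /lin /deg !(big_morph Posz PoszD (erefl _)) -sumrB.
by apply: eq_bigr => i _; rewrite mxE mulrBr !PoszM.
Qed.

Lemma big_latticeP (a b : 'X_{1..n}) :
  big_lattice (\row_i ((a i)%:Z - (b i)%:Z)) <->
  deg weight_x a = deg weight_x b /\ deg weight_y a = deg weight_y b.
Proof.
rewrite /big_lattice /= !lin_deg; split=> [[/eqP+ /eqP]|[-> ->]].
  by rewrite !subr_eq0 => /eqP[->] /eqP[->].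
by rewrite !subrr.
Qed.

Lemma small_latticeP (a b : 'X_{1..n}) :
  small_lattice (\row_i ((a i)%:Z - (b i)%:Z)) <->
  [/\ deg weight_x a = deg weight_x b, deg weight_y a = deg weight_y b &
      odd (deg weight_t a) = odd (deg weight_t b)].
Proof.
split=> [[/big_latticeP[-> ->] [q]]|[ax ay at']].
  by rewrite lin_deg; split => //; lia.
split; first exact/big_latticeP.
exists ((deg weight_t a)./2%:Z - (deg weight_t b)./2%:Z).
by rewrite lin_deg; lia.
Qed.

Lemma degD w a b : deg w (a + b)%MM = (deg w a + deg w b)%N.
Proof. by rewrite /deg -big_split; apply: eq_bigr => i _; rewrite mnmDE mulnDr. Qed.

Lemma degMn w a c : deg w (a *+ c)%MM = (deg w a * c)%N.
Proof. by rewrite /deg big_distrl; apply: eq_bigr => i _; rewrite mulmnE mulnA. Qed.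

Lemma deg1 w i : deg w U_(i)%MM = w i.
Proof.
rewrite /deg (bigD1 i) //= mnm1E eqxx muln1 big1 ?addn0 // => j ji.
by rewrite mnm1E eq_sym (negbTE ji) muln0.
Qed.

Lemma degE w a : deg w a = (w 0 * a 0%R + w 1 * a (lift ord0 0%R) +
  w 2 * a (lift ord0 (lift ord0 0%R)) + \sum_(i < m'.+1) w i.+3 * a (tail_ord i))%N.
Proof. by rewrite /deg 3!big_ord_recl !addnA. Qed.

Lemma deg_eq0 a : deg weight_x a = 0%N -> deg weight_y a = 0%N -> a = 0%MM.
Proof.
move=> ax ay.
have : (\sum_(i < n) (weight_x i + weight_y i) * a i == 0)%N.
  under eq_bigr do rewrite mulnDl.
  by rewrite big_split /= -/(deg weight_x a) -/(deg weight_y a) ax ay.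
rewrite sum_nat_eq0 => /forallP az; apply/mnmP => i; rewrite mnm0E.
by have := az i; rewrite muln_eq0 eqn0Ngt weight_gt0 => /eqP.
Qed.

(** X_2 is alone in its degree: degree 0 in y leaves only X_0 and X_2, the parity makes the exponent
    of X_2 odd, and degree r+1 in x leaves room for just one X_2. *)
Lemma deg_eq_X2 a : deg weight_x a = r.+1 -> deg weight_y a = 0%N ->
  odd (deg weight_t a) -> a = U_(lift ord0 (lift ord0 0%R))%MM.
Proof.
move=> ax ay.
have := ay; rewrite degE /= mul0n add0n mul1n addn0 => /eqP.
rewrite addn_eq0 => /andP[/eqP a1]; rewrite sum_nat_eq0 => /forallP a3.
have {}a3 i : a (tail_ord i) = 0%N.
  by have := a3 i; rewrite /= /weight_y nth_default // mul1n => /eqP.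
rewrite degE /= a1 big1 => [|i _]; last by rewrite a3 muln0.
rewrite !mul0n !add0n mul1n addn0 => a2.
have a0 : a 0%R = 0%N /\ a (lift ord0 (lift ord0 0%R)) = 1%N.
  move: ax; rewrite degE /= a1 big1 => [|i _]; last by rewrite a3 muln0.
  rewrite /weight_x /= mul1n.
  case: (a (lift _ _)) a2 => [|[|c]] //= _; first by lia.
  by rewrite !mulnS; lia.
apply/mnmP => i; rewrite mnm1E.
by have [->|->|->|[j ->]] := ord4P i; rewrite ?a1 ?a3 ?a0.1 ?a0.2.
Qed.

(** * The ideal of the saturation is a complete intersection *)

Section LatticeIdeals.
Variable k : fieldType.
Local Notation A := {mpoly k[n]}.
Local Notation X0 := ('X_(0 : 'I_n) : A).
Local Notation X1 := ('X_(lift ord0 0 : 'I_n) : A).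

Definition mono_xy (c d : nat) : A := X0 ^+ c * X1 ^+ d.

Lemma mono_xyE c d :
  mono_xy c d = 'X_[U_(0%R : 'I_n) *+ c + U_(lift ord0 0%R : 'I_n) *+ d].
Proof. by rewrite /mono_xy mpolyXD !mpolyXn. Qed.

(* Interpolates between the identity (j = 0) and the reduction modulo the ideal
   of big_lattice (j = m). *)
Definition subst_xy (j : nat) : A -> A := comp_mpoly
  [tuple if (i < j.+2)%N then mono_xy (weight_x i) (weight_y i) else 'X_i | i < n].
HB.instance Definition _ j := GRing.RMorphism.on (subst_xy j).

Lemma subst_xyX j i : subst_xy j 'X_i =
  if (i < j.+2)%N then mono_xy (weight_x i) (weight_y i) else 'X_i.
Proof. by rewrite /subst_xy comp_mpolyX_tnth tuple_of_tnth. Qed.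

Lemma subst_xyC j c : subst_xy j c%:MP = c%:MP.
Proof. exact: comp_mpolyC. Qed.

Lemma subst_xyX0 j : subst_xy j X0 = X0.
Proof. by rewrite subst_xyX /= /mono_xy expr1 expr0 mulr1. Qed.

Lemma subst_xyX1 j : subst_xy j X1 = X1.
Proof. by rewrite subst_xyX /= /mono_xy expr1 expr0 mul1r. Qed.

Lemma subst_xy_mono j c d : subst_xy j (mono_xy c d) = mono_xy c d.
Proof.
by rewrite /mono_xy rmorphM !rmorphXn /= subst_xyX0 subst_xyX1.
Qed.

(** All these substitutions fix the monomials in X_0 and X_1, so the later one absorbs the earlier
    one. *)
Lemma subst_xy_comp i j p : (i <= j)%N -> subst_xy j (subst_xy i p) = subst_xy j p.
Proof.
move=> ij; apply: (mpoly_rmorph_eq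
  (f := subst_xy j \o subst_xy i) (g := subst_xy j)) => [c|l] /=.
  by rewrite !subst_xyC.
rewrite subst_xyX; case: ifP => // li; rewrite subst_xy_mono subst_xyX.
by rewrite (leq_trans li) // !ltnS.
Qed.

Lemma subst_xy_eq0 i j p : (i <= j)%N -> subst_xy i p = 0 -> subst_xy j p = 0.
Proof. by move=> ij p0; rewrite -(subst_xy_comp p ij) p0 rmorph0. Qed.

Lemma subst_xyXm a :
  subst_xy m 'X_[a] = mono_xy (deg weight_x a) (deg weight_y a).
Proof.
rewrite mpolyXE_id rmorph_prod /mono_xy -!prodrXr -big_split /=.
apply: eq_bigr => i _; rewrite rmorphXn /= subst_xyX ltn_ord /mono_xy.
by rewrite exprMn -!exprM.
Qed.

Definition ker_xy j : {pred A} := [pred p | subst_xy j p == 0].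

Lemma prime_ker_xy j : prime_ideal (ker_xy j).
Proof. exact: prime_ideal_ker (subst_xy j). Qed.

Lemma chain_ker_xy : prime_chain (ker_xy m) m ker_xy.
Proof.
split=> [i _|i im|//]; first exact: prime_ker_xy.
split=> [p|sub].
  by move=> /eqP p0; apply/eqP; apply: (subst_xy_eq0 (leqnSn i)).
have i2 : (i.+2 < n)%N by [].
(* X_(i+2) is the one variable that [subst_xy i.+1] replaces by a monomial in X_0, X_1 whereas
   [subst_xy i] keeps it. *)
have : 'X_(Ordinal i2) - subst_xy i.+1 'X_(Ordinal i2) \in ker_xy i.
  by apply: sub; apply/eqP; rewrite rmorphB /= subst_xy_comp // subrr.
move=> /eqP; rewrite rmorphB /=.
rewrite !subst_xyX /= ltnn ltnSn subst_xy_mono.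
move/(congr1 (mcoeff U_(Ordinal i2))); rewrite mcoeffB mcoeff0 mcoeffX eqxx.
rewrite mono_xyE mcoeffX.
case: eqP => [/(congr1 (fun u : 'X_{1..n} => u (Ordinal i2)))|_] /=.
  by rewrite mnmDE !mulmnE !mnm1E eqxx -!val_eqE /=.
by rewrite subr0 => /eqP; rewrite oner_eq0.
Qed.

Lemma alg_indep_xy : alg_indep (ker_xy m) [tuple X0; X1].
Proof.
move=> p; rewrite inE => /eqP p0.
(* Substituting [z] sends X_0 and X_1 back to the two variables of [p], and so recovers [p]. *)
pose z : n.-tuple {mpoly k[2]} := [tuple nth 0 [:: 'X_0; 'X_1] i | i < n].
have := congr1 (comp_mpoly z) p0; rewrite comp_mpoly0 => <-.
apply/esym; apply: (mpoly_rmorph_eq (f := comp_mpoly z \o subst_xy m \o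
  comp_mpoly [tuple X0; X1]) (g := idfun)) => [c|i] /=.
  by rewrite comp_mpolyC subst_xyC comp_mpolyC.
rewrite comp_mpolyXU.
have [->|->] : i = ord0 \/ i = lift ord0 ord0.
- by case: (unliftP ord0 i) => [l ->|->]; [right; rewrite (ord1 l)|left].
- rewrite /= subst_xyX0 comp_mpolyX_tnth.
  by rewrite tuple_of_tnth.
- rewrite /= subst_xyX1 comp_mpolyX_tnth.
  by rewrite tuple_of_tnth /=; congr ('X__); apply: val_inj.
Qed.

Lemma height_ker_xy : prime_height (ker_xy m) m.
Proof.
split=> [|h Q chain]; first by exists ker_xy; apply: chain_ker_xy.
by have := chain_alg_indep chain alg_indep_xy; rewrite addn2 !ltnS.
Qed.

Definition xy_gens : m.-tuple A :=
  [tuple 'X_(lift ord0 (lift ord0 i)) -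
         subst_xy m 'X_(lift ord0 (lift ord0 i)) | i < m].

Lemma big_ideal_sub_ker : {subset lattice_ideal k big_lattice <= ker_xy m}.
Proof.
apply: ideal_gen_sub => [|f [a [b [/big_latticeP[ax ay] ->]]]].
  by have [] := prime_ker_xy m.
by rewrite inE rmorphB /= !subst_xyXm ax ay subrr.
Qed.

Lemma gens_sub_big_ideal :
  {subset ideal_gen [set` xy_gens] <= lattice_ideal k big_lattice}.
Proof.
apply: ideal_gen_mono => f /mapP[i _ ->]; apply: mem_ideal_gen.
set l := lift _ _; exists U_(l)%MM.
exists (U_(0%R : 'I_n) *+ weight_x l + U_(lift ord0 0%R : 'I_n) *+ weight_y l)%MM.
rewrite subst_xyX ltn_ord mono_xyE; split=> //.
apply/big_latticeP; rewrite !degD !degMn !deg1 /=.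
by rewrite !mul1n !mul0n addn0.
Qed.

(** An element p of the kernel equals p - [subst_xy m p], and modulo the generators every X_i is
    congruent to its image. *)
Lemma ker_sub_gens : {subset ker_xy m <= ideal_gen [set` xy_gens]}.
Proof.
have [[K0 K1 _] _] := prime_ker_xy m.
(* Properness is inherited from the kernel, which contains the generators. *)
have Gi : idealr_closed (ideal_gen [set` xy_gens] : {pred A}).
  by apply/idealr_gen/(contra _ K1) => /gens_sub_big_ideal/big_ideal_sub_ker.
pose G : idealr A := HB.pack (ideal_gen [set` xy_gens] : {pred A})
  (isIdealr.Build A (ideal_gen [set` xy_gens]) Gi).
move=> p /eqP p0; rewrite -[p]subr0 -p0.
apply: (@comp_mpoly_congr _ _ G) => i.
rewrite tuple_of_tnth -subst_xyX; case: (unliftP ord0 i) => [i1|] ->; last first.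
  by rewrite subst_xyX0 subrr rpred0.
case: (unliftP ord0 i1) => [l|] ->; last by rewrite subst_xyX1 subrr rpred0.
by apply: mem_ideal_gen; apply/tnthP; exists l; rewrite tuple_of_tnth.
Qed.

Lemma complete_intersection_big : complete_intersection (lattice_ideal k big_lattice).
Proof.
exists m; split; last first.
  exists xy_gens => f; apply/idP/idP => [/big_ideal_sub_ker/ker_sub_gens //|].
  exact: gens_sub_big_ideal.
split; first by exists (ker_xy m); split;
  [exact: prime_ker_xy|exact: big_ideal_sub_ker|exact: height_ker_xy].
(* A prime over the lattice ideal contains the kernel, so it can take the place of the kernel at the
   top of the chain. *)
move=> P Pp IP; apply: prime_chain_sub chain_ker_xy Pp _.
by move=> p /ker_sub_gens/gens_sub_big_ideal/IP.
Qed.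

(* Over the group of degrees, translation by (r,0;1) maps the degree of X_i to
   that of X^(shift i), although (r,0;1) is not the degree of a monomial. *)
Definition shift (i : 'I_n) : 'X_{1..n} :=
  match nat_of_ord i with
  | 0 => U_(lift ord0 (lift ord0 0%R))
  | 1 => U_(0%R) *+ r + U_(tail_ord 0%R)
  | 2 => U_(0%R) *+ (r.*2).+1
  | _ => U_(0%R) *+ r + U_(lift ord0 0%R)
  end.

Lemma deg_shift i : [/\ deg weight_x (shift i) = (weight_x i + r)%N,
  deg weight_y (shift i) = weight_y i &
  odd (deg weight_t (shift i)) = ~~ odd (weight_t i)].
Proof.
have [->|->|->|[j ->]] := ord4P i; rewrite /shift /= ?degD ?degMn !deg1.
- by rewrite /weight_x /weight_y /weight_t /= add1n.
- by rewrite /weight_x /weight_y /weight_t /= mul1n !addn0.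
- by split=> //; rewrite /weight_x /= mul1n -addnn addSn.
- by split; rewrite /weight_x /weight_y /weight_t /=
    ?[nth _ [::] _]nth_default //= mul1n addn0.
Qed.

(** * The ideal of the small lattice is not Cohen-Macaulay *)

Local Notation I := (lattice_ideal k small_lattice).
Local Notation R := {ideal_quot I}.
Local Open Scope quotient_scope.

Lemma small_ideal_sub_ker : {subset I <= ker_xy m}.
Proof.
move=> f fI; apply: big_ideal_sub_ker.
by apply: lattice_ideal_mono f fI => u [].
Qed.

(** Both products are monomials of degree deg X_i + deg X_j + (r,0;1), so their difference is a
    generator of the ideal. *)
Lemma shift_swap i j :
  \pi_R 'X_i * \pi_R 'X_[shift j] = \pi_R 'X_j * \pi_R 'X_[shift i].
Proof.
rewrite -!(rmorphM (\pi_R : A -> R)); apply/piq_eq; apply: mem_ideal_gen.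
exists (U_(i) + shift j)%MM, (U_(j) + shift i)%MM; rewrite !mpolyXD; split=> //.
apply/small_latticeP; rewrite !degD !deg1.
have [-> -> ti] := deg_shift i; have [-> -> tj] := deg_shift j.
by split; rewrite ?oddD ?ti ?tj; [lia|lia|case: odd; case: odd].
Qed.

(** The coefficient of X_2 in this difference is 1. In the ideal it is always 0, because 1 and X_2
    are each the only monomial of their degree. *)
Lemma X2_notin (h : A) : 'X_(lift ord0 (lift ord0 0)) - X0 * h \notin I.
Proof.
set i2 := lift _ _; apply/negP => /(@lattice_ideal_coef k _ _ i2) f0.
suff : (1 : k) = 0 by move/eqP; rewrite oner_eq0.
rewrite -f0 => [|a b /small_latticeP[ax ay at']].
  rewrite mcoeffB mcoeff_linM !mcoeffX !eqxx.
  rewrite (_ : (_ == U_(i2)%MM) = false); last first.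
    by apply/eqP => /mnmP/(_ i2); rewrite !mnm1E eqxx.
  rewrite (_ : (_ == 0%MM) = false) ?mul0r ?addr0 ?subr0 //.
  by apply/eqP => /mnmP/(_ 0); rewrite !mnm1E mnm0E eqxx.
have deg0 w : deg w 0%MM = 0%N.
  by rewrite /deg big1 // => l _; rewrite mnm0E muln0.
split; apply/eqP/eqP => e; move: ax ay at'; rewrite e ?deg0 ?deg1.
- by move=> /esym ax /esym ay _; apply: deg_eq0.
- by move=> ax ay _; apply: deg_eq0.
- by move=> /esym ax /esym ay /esym at'; apply: deg_eq_X2.
- by move=> ax ay at'; apply: deg_eq_X2.
Qed.

Definition kill_X0 : A -> A := comp_mpoly [tuple if i == 0 then 0 else 'X_i | i < n].
HB.instance Definition _ := GRing.RMorphism.on kill_X0.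

(** The preimages under [subst_xy m] of the primes 0, (X_0) and (X_0, X_1) of the polynomial ring in
    X_0 and X_1. *)
Definition origin_chain (i : nat) : {pred A} := match i with
  | 0 => ker_xy m
  | 1 => [pred p | kill_X0 (subst_xy m p) == 0]
  | _ => @origin k n
  end.

Lemma kill_X0_X i : kill_X0 'X_i = if i == 0 then 0 else 'X_i.
Proof. by rewrite /kill_X0 comp_mpolyX_tnth tuple_of_tnth. Qed.

(** By [weight_gt0] every variable is sent to a nonconstant monomial or to 0, hence to an element
    vanishing at the origin. *)
Lemma kill_X0_origin p : (kill_X0 (subst_xy m p)).@[fun=> 0] = p.@[fun=> 0].
Proof.
pose ev : {rmorphism A -> k} := meval (fun=> 0).
apply: (mpoly_rmorph_eq (f := ev \o kill_X0 \o subst_xy m) (g := ev)) => [c|i] /=.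
  by rewrite subst_xyC /kill_X0 comp_mpolyC.
rewrite subst_xyX ltn_ord mevalXU /mono_xy !(rmorphM, rmorphXn) /= !kill_X0_X /=.
rewrite meval0 mevalXU !expr0n.
by have := weight_gt0 i; case: (weight_x i) => [|c]; case: (weight_y i) => [|d];
  rewrite ?mul0r ?mulr0.
Qed.

Lemma origin_chain_sub j : {subset origin_chain j <= origin_chain j.+1}.
Proof.
case: j => [|[|j]] p; last exact: id.
- by move=> /eqP p0; apply/eqP; rewrite p0 rmorph0.
- by move=> /eqP p0; apply/eqP; rewrite -kill_X0_origin p0 meval0.
Qed.

Lemma small_ideal_sub_origin_chain i : {subset I <= origin_chain i}.
Proof.
move=> f /small_ideal_sub_ker f0.
by elim: i => // i; apply: origin_chain_sub.
Qed.

Lemma chain_origin : prime_chain (@origin k n) 2 origin_chain.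
Proof.
split=> [i _|i i2|//].
  case: i => [|[|i]]; first exact: prime_ker_xy.
    exact: (prime_ideal_ker (kill_X0 \o subst_xy m)).
  exact: (prime_ideal_ker (meval (fun=> 0 : k) : {rmorphism A -> k})).
split; first exact: origin_chain_sub.
have X_neq0 (l : 'I_n) : ('X_l : A) <> 0.
  move/(congr1 (mcoeff U_(l))); rewrite mcoeffX mcoeff0 eqxx => /eqP.
  by rewrite oner_eq0.
case: i i2 => [|[|i]] // _ sub.
  have /sub/eqP : X0 \in origin_chain 1.
    by apply/eqP; rewrite subst_xyX0 kill_X0_X.
  by rewrite subst_xyX0; apply: X_neq0.
have /sub/eqP : X1 \in origin_chain 2 by apply/eqP; rewrite mevalXU.
by rewrite subst_xyX1 kill_X0_X; apply: X_neq0.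
Qed.

Lemma small_not_cohen_macaulay : ~ cohen_macaulay_ideal I.
Proof.
(* The index 0 is chosen because [shift 0] is the exponent of X_2: the fraction w = X_2 / X_0 is not
   in the ring, by [X2_notin]. *)
apply: (@depth_one_not_cohen_macaulay R n (fun i => \pi_R 'X_i)
  (fun i => \pi_R 'X_[shift i]) shift_swap (quot_ideal I (@origin k n))
  (fun i => quot_ideal I (origin_chain i)) 0).
- by apply: maximal_quot (@maximal_origin k n) => f;
     apply: (small_ideal_sub_origin_chain 2).
- exact: prime_chain_quot small_ideal_sub_origin_chain chain_origin.
- move=> f /origin_span[p fE]; exists (fun i => \pi_R (p i)).
  rewrite -[f]reprK fE (rmorph_sum (\pi_R : A -> R)).
  by apply: eq_bigr => i _; rewrite /= (rmorphM (\pi_R : A -> R)).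
- move=> h; apply/eqP; rewrite -[h]reprK -(rmorphM (\pi_R : A -> R)) => /piq_eq.
  by apply/negP/X2_notin.
Qed.

End LatticeIdeals.
End Example.


(** * Infinitely many lattices *)

Lemma small_lattice_inj m' : injective (@small_lattice m').
Proof.
move=> r s rs.
have : small_lattice s (witness m' r *+ 2) by rewrite -rs; apply: small_witness2.
(* For the weights of parameter s, the witness of parameter r has x-degree s - r, which must be
   0. *)
move=> [[/eqP+ _] _]; rewrite linMn mulrn_eq0 lin_xE !mxE /= mulr1 addrC subr_eq0.
by move=> /eqP[].
Qed.

Theorem theorem3p6 (k : fieldType) (m : nat) (hm : (2 <= m)%N) :
  infinite_set [set X : {n : nat & set 'rV[int]_n} |
    let n := projT1 X in
    let L : set 'rV[int]_n := projT2 X in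
    [/\ lattice L, positive L, ~ saturated L, lattice_rank L m
      & (complete_intersection (lattice_ideal k L) /\
         ~ cohen_macaulay_ideal (lattice_ideal k (saturation L))) \/
        (complete_intersection (lattice_ideal k (saturation L)) /\
         ~ cohen_macaulay_ideal (lattice_ideal k L))]].
Proof.
case: m hm => [|[|m]] // _.
pose F r : {n : nat & set 'rV[int]_n} := existT _ m.+4 (@small_lattice m r).
set S := [set _ | _] => finS; apply: infinite_nat.
have -> : [set: nat] = F @^-1` S.
  apply/esym/seteqP; split=> // r _.
  split; [exact: lattice_small|exact: positive_small|exact: small_not_saturated
    |exact: rank_small|right].
  split; last exact: small_not_cohen_macaulay.
  by rewrite [projT2 _]/= saturation_small; apply: complete_intersection_big.
apply: finite_preimage finS => r s _ _ rs; apply: (@small_lattice_inj m).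
by apply: (Eqdep_dec.inj_pair2_eq_dec _ PeanoNat.Nat.eq_dec) rs.
Qed.
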